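(* Let $f:\mathbb{R}^d\to\mathbb{R}$ be convex and differentiable with locally Lipschitz gradient and with a minimizer $x_\star$, let $B\succ0$, $x_0\in\mathbb{R}^d$, $L_0>0$, $k\in\mathbb{N}$. Consider any sequences $x_n,\tau_n,z_{n+1},\Delta_n$ (with estimates $L_n$ and gradients $g_n=B\nabla f(x_n)$) generated by the algorithm BSPGM (defined in the context) with final iteration $N$. Then each serious step $n\in\{0,\dots,N\}$ (that is, each $n$ with $\tau_n\neq0$) satisfies $$f(x_n)-\frac{1}{2L_n}\|g_n\|_B^2-f(x_\star)\le\frac{\frac{L_n}{2}\|x_0-x_\star\|_B^2+\Delta_n}{\tau_n}\qquad\text{if } n<N,$$ $$f(x_N)-f(x_\star)\le\frac{\frac{L_N}{2}\|x_0-x_\star\|_B^2+\Delta_N}{\tau_N}\qquad\text{if } n=N.$$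
   Context: **Notation.** For symmetric positive definite $B$: $\langle x,y\rangle_B=\langle x,B^{-1}y\rangle$, $\|x\|_B=\sqrt{\langle x,x\rangle_B}$, $\nabla_B f(x)=B\nabla f(x)$ (the gradient of $f$ under $\langle\cdot,\cdot\rangle_B$). Write $f_i=f(x_i)$, $g_i=\nabla_B f(x_i)$, and $$\tilde L_B(x,y)=\frac{\frac12\|\nabla_B f(x)-\nabla_B f(y)\|_B^2}{f(y)-f(x)-\langle\nabla_B f(x),y-x\rangle_B}\qquad(\text{convention }0/0=0),$$ evaluated so that $\tilde L_B(x_m,x_n)\le L$ is equivalent to $f_m-f_n-\langle g_n,x_m-x_n\rangle_B-\frac1{2L}\|g_m-g_n\|_B^2\ge0$; that is, $\tilde L_B(x_m,x_n)$ is the smallest $L$ for which this cocoercivity inequality holds. **BSPGM (Backtracking-free Subgame Perfect Gradient Method).** Input: $f$, memory size $k$, $x_0$, $L_0>0$, $B\succ0$. Initialize $\tau_0=1$, $z_1=x_0-\frac1{L_0}g_0$, $\Delta_0=0$, $L_1=L_0$. For $n=1,2,\dots$ up to the last iteration $N$ (chosen by some stopping condition): 1. Memory: maintain a set $I_n$ of at most $k$ past indices (written $[n-k,n-1]$ in general; all of $\{0,\dots,n-1\}$ if $n\le k$), obtained from $I_{n-1}$ by adding $n-1$ and, if there are more than $k$ indices, discarding the oldest one, except that if the oldest one is the only index with $\tau_i>0$, then the second oldest is discarded instead. The data $(x_i,f_i,g_i,z_{i+1},\tau_i,L_i,\Delta_i)$, $i\in I_n$, are kept. 2. Let $J=\{i\in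 I_n:\tau_i>0\}$ (nonempty), $v_i=f_i-\frac1{2L_n}\|g_i\|_B^2$, $m\in\arg\min_{i\in J}v_i$, $s=\max J$, $\delta_n=L_n\tau_s\left(\frac1{L_s^2}-\frac1{L_n^2}\right)\frac12\|g_s\|_B^2$, and for $i\in I_n$ $$a_i=\tau_i\Big(f_i-\frac1{2L_i}\|g_i\|_B^2\Big)+\frac{L_i}2\|z_{i+1}-x_0\|_B^2-v_m\tau_i,\qquad b_i=f_i-\langle g_i,x_i-x_0\rangle_B-v_m.$$ Let $Z$ be the matrix with columns $\frac{L_i}{L_n}(z_{i+1}-x_0)$ and $G$ the matrix with columns $\frac{g_i}{L_n}$, $i\in I_n$. For $\rho,\gamma\in\mathbb{R}^{I_n}$ put $$\epsilon(\rho,\gamma)=\sum_{i}\rho_ia_i+\sum_i\gamma_ib_i+\delta_n-\frac{L_n}2\|Z\rho-G\gamma\|_B^2 .$$ 3. Subproblem: maximize $\sum_i\rho_i\tau_i+\sum_i\gamma_i$ subject to $\epsilon(\rho,\gamma)\ge0$, $\rho\ge0$, $\gamma\ge0$. If it is unbounded, BSPGM stops, returning $x_m-\frac1{L_n}g_m$ (no $\tau_n,z_{n+1},\Delta_n$ are generated). Otherwise take an optimal $(\rho,\gamma)$ and set $\tau'=\sum_i\rho_i\tau_i+\sum_i\gamma_i$, $z'=x_0+Z\rho-G\gamma$, $\Delta'=\sum_i\rho_i\Delta_i$. 4. Update: $\tau_n=\tau'+\frac{1+\sqrt{1+8\tau'}}2$ if $n<N$, and $\tau_n=\tau'+\sqrt{\tau'}$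 if $n=N$ (final step); $x_n=\frac{\tau'}{\tau_n}\left(x_m-\frac1{L_n}g_m\right)+\frac{\tau_n-\tau'}{\tau_n}z'$; $z_{n+1}=z'-\frac{\tau_n-\tau'}{L_n}g_n$ with $g_n=\nabla_Bf(x_n)$; $\Delta_n=\Delta'+\delta_n$. 5. If $\tilde L_B(x_m,x_n)>L_n$ (a ''null step''): reset $\tau_n=0$, $z_{n+1}=x_0$, $\Delta_n=0$ and set $L_{n+1}=\max\{\tilde L_B(x_m,x_n),2L_n\}$. Otherwise (a ''serious step'') $L_{n+1}=L_n$. *)

(* Defs.v *)
From HB Require Import structures.
From mathcomp Require Import all_boot all_order all_algebra.
From mathcomp Require Import all_classical all_reals all_analysis.

Set Implicit Arguments.
Unset Strict Implicit.
Unset Printing Implicit Defensive.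

Import Order.TTheory GRing.Theory Num.Theory.
Import numFieldNormedType.Exports.

Local Open Scope classical_set_scope.
Local Open Scope ring_scope.

Section Geometry.
Variables (R : realType) (d : nat).
Implicit Types (B : 'M[R]_d) (x y : 'cV[R]_d) (f : 'cV[R]_d -> R).

Definition sym_posdef B :=
  B^T = B /\ forall x, x != 0 -> 0 < (x^T *m B *m x) 0 0.

Definition innerB B x y : R := (x^T *m (invmx B *m y)) 0 0.

Definition normB B x : R := Num.sqrt (innerB B x x).

Definition gradient f x : 'cV[R]_d := \col_i 'D_(delta_mx i 0) f x.

Definition gradB f B x : 'cV[R]_d := B *m gradient f x.

Definition locally_lipschitz (F : 'cV[R]_d -> 'cV[R]_d) :=
  forall a : 'cV[R]_d, exists2 U : set 'cV[R]_d,
    nbhs a U & [lipschitz F x | x in U].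

(* The convention 0 / 0 = 0 is the value of division by zero in MathComp. *)
Definition Ltilde f B x y : R :=
  (2^-1 * normB B (gradB f B x - gradB f B y) ^+ 2) /
  (f y - f x - innerB B (gradB f B x) (y - x)).

End Geometry.

Section BSPGM.
Variables (R : realType) (d : nat).
Variables (f : 'cV[R]_d -> R) (B : 'M[R]_d).
Variables (k : nat) (x0 : 'cV[R]_d) (L0 : R) (N : nat).
(* z is indexed as in the algorithm: z n.+1 is produced by step n, and z 0 is
   never used. *)
Variables (x : nat -> 'cV[R]_d) (tau : nat -> R) (z : nat -> 'cV[R]_d).
Variables (Delta L : nat -> R).

Local Notation "<[ u , v ]>" := (innerB B u v).
Local Notation "|[ u ]|" := (normB B u).
Local Notation g i := (gradB f B (x i)).

(* Memories are listed from the oldest to the newest index; the exceptional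
   case discards the second oldest index. *)
Definition discard (I : seq nat) : seq nat :=
  if I is i :: I' then
    if [seq j <- I | 0 < tau j] == [:: i] then i :: behead I' else I'
  else [::].

Fixpoint memory (n : nat) : seq nat :=
  if n is n'.+1 then
    let I := rcons (memory n') n' in
    if (size I <= k)%N then I else discard I
  else [::].

Definition active n : seq nat := [seq i <- memory n | 0 < tau i].

Definition vval n i : R := f (x i) - (2 * L n)^-1 * |[g i]| ^+ 2.

Definition is_argmin_v n m :=
  m \in active n /\ {in active n, forall i, vval n m <= vval n i}.

Definition delta n : R :=
  let s := (\max_(i <- active n) i)%N in
  L n * tau s * ((L s ^+ 2)^-1 - (L n ^+ 2)^-1) * (2^-1 * |[g s]| ^+ 2).

Definition acoef n m i : R :=
  tau i * (f (x i) - (2 * L i)^-1 * |[g i]| ^+ 2)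
  + L i / 2 * |[z i.+1 - x0]| ^+ 2 - vval n m * tau i.

Definition bcoef n m i : R :=
  f (x i) - <[g i, x i - x0]> - vval n m.

(* Vectors and matrix columns indexed by I_n are indexed by positions j in
   memory n. *)
Local Notation msize n := (size (memory n)).

Definition idx n (j : 'I_(msize n)) : nat := nth 0%N (memory n) j.

Definition Zmat n : 'M[R]_(d, msize n) :=
  \matrix_(i, j) (L (idx j) / L n *: (z (idx j).+1 - x0)) i 0.

Definition Gmat n : 'M[R]_(d, msize n) :=
  \matrix_(i, j) ((L n)^-1 *: g (idx j)) i 0.

Definition slack n m (rho gamma : 'cV[R]_(msize n)) : R :=
  \sum_j rho j 0 * acoef n m (idx j) + \sum_j gamma j 0 * bcoef n m (idx j)
  + delta n - L n / 2 * |[Zmat n *m rho - Gmat n *m gamma]| ^+ 2.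

Definition objective n (rho gamma : 'cV[R]_(msize n)) : R :=
  \sum_j rho j 0 * tau (idx j) + \sum_j gamma j 0.

Definition feasible n m (rho gamma : 'cV[R]_(msize n)) :=
  [/\ 0 <= slack m rho gamma,
      forall j, 0 <= rho j 0 & forall j, 0 <= gamma j 0].

Definition subproblem_unbounded n m :=
  forall M : R, exists rho gamma : 'cV[R]_(msize n),
    feasible m rho gamma /\ M < objective rho gamma.

Definition subproblem_optimal n m (rho gamma : 'cV[R]_(msize n)) :=
  feasible m rho gamma /\
  forall rho' gamma' : 'cV[R]_(msize n), feasible m rho' gamma' ->
    objective rho' gamma' <= objective rho gamma.

(* The null-step test compares L_n with the least constant for which
     f_m - f_n - <g_n, x_m - x_n>_B - |g_m - g_n|_B^2 / (2 L) >= 0,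
   whose denominator is the Bregman term based at x_n; in terms of Ltilde this
   is Ltilde (x n) (x m). *)
Definition bspgm_step n :=
  exists m : nat, exists rho gamma : 'cV[R]_(msize n),
  [/\ is_argmin_v n m, subproblem_optimal m rho gamma &
    let tau' := objective rho gamma in
    let z' := x0 + Zmat n *m rho - Gmat n *m gamma in
    let Delta' := \sum_j rho j 0 * Delta (idx j) in
    let tau_n := if (n < N)%N then tau' + (1 + Num.sqrt (1 + 8 * tau')) / 2
                 else tau' + Num.sqrt tau' in
    let L_mn := Ltilde f B (x n) (x m) in
    x n = tau' / tau_n *: (x m - (L n)^-1 *: g m)
          + (tau_n - tau') / tau_n *: z' /\
    if L n < L_mn then
      [/\ tau n = 0, z n.+1 = x0, Delta n = 0 &
          L n.+1 = Num.max L_mn (2 * L n)]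
    else
      [/\ tau n = tau_n, z n.+1 = z' - (tau_n - tau') / L n *: g n,
          Delta n = Delta' + delta n & L n.+1 = L n]].

Definition bspgm_init :=
  [/\ x 0%N = x0, tau 0%N = 1, z 1%N = x0 - L0^-1 *: g 0%N, Delta 0%N = 0 &
      L 0%N = L0 /\ L 1%N = L0].

Definition bspgm_stops n :=
  exists2 m : nat, is_argmin_v n m & subproblem_unbounded n m.

(* T is the last index for which an iterate is generated: it is the planned
   final iteration N, unless the subproblem of iteration T.+1 <= N is
   unbounded. Values of the sequences beyond T are unconstrained. *)
Definition bspgm_run T :=
  [/\ bspgm_init,
      forall n, (1 <= n <= T)%N -> bspgm_step n &
      T = N \/ (T < N)%N /\ bspgm_stops T.+1].

End BSPGM.

(* Main.v *)
(* Call an index i certified if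
     tau_i (f_i - |g_i|^2 / (2 L_i) - f_opt) + L_i/2 |z_{i+1} - x_opt|^2
       <= L_i/2 |x_0 - x_opt|^2 + Delta_i.
   Expanding |z_{i+1} - x_opt|^2 around x_0 makes this affine in
   L_i (z_{i+1} - x_0), so the combination of the certified inequalities with
   weights rho and of the convexity inequalities f_i + <g_i, x_opt - x_i> <= f_opt
   with weights gamma, together with feasibility (nonnegative slack), gives
     tau' (v_m - f_opt) + L_n/2 |z' - x_opt|^2
       <= L_n/2 |x_0 - x_opt|^2 + Delta' + delta_n.
   On a serious step, add tau' times the cocoercivity inequality between x_m
   and x_n and tau_n - tau' times convexity between x_n and x_opt; the choice of
   tau_n makes (tau_n - tau')^2 equal to tau_n + tau' (or to tau' on the final
   step), which is exactly the coefficient needed for |g_n|^2. *)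
Require Import Defs.
From HB Require Import structures.
From mathcomp Require Import all_boot all_order all_algebra.
From mathcomp Require Import all_classical all_reals all_analysis.
From mathcomp Require Import ring lra.

Set Implicit Arguments.
Unset Strict Implicit.
Unset Printing Implicit Defensive.

Import Order.TTheory GRing.Theory Num.Theory.
Import numFieldNormedType.Exports.

Local Open Scope classical_set_scope.
Local Open Scope ring_scope.

(** * The inner product weighted by the inverse of [B] *)

Section InnerProduct.
Variables (R : realType) (d : nat) (B : 'M[R]_d).
Implicit Types (u v w : 'cV[R]_d) (a : R).

Local Notation "<[ u , v ]>" := (innerB B u v).

Lemma innerBDl u v w : <[u + v, w]> = <[u, w]> + <[v, w]>.
Proof. by rewrite /innerB linearD mulmxDl mxE. Qed.

Lemma innerBDr u v w : <[u, v + w]> = <[u, v]> + <[u, w]>.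
Proof. by rewrite /innerB !mulmxDr mxE. Qed.

Lemma innerBZl a u v : <[a *: u, v]> = a * <[u, v]>.
Proof. by rewrite /innerB linearZ -scalemxAl mxE. Qed.

Lemma innerBZr a u v : <[u, a *: v]> = a * <[u, v]>.
Proof. by rewrite /innerB -!scalemxAr mxE. Qed.

Lemma innerBNl u v : <[- u, v]> = - <[u, v]>.
Proof. by rewrite -scaleN1r innerBZl mulN1r. Qed.

Lemma innerBNr u v : <[u, - v]> = - <[u, v]>.
Proof. by rewrite -scaleN1r innerBZr mulN1r. Qed.

Lemma innerB_mull n (A : 'M[R]_(d, n)) (w : 'cV[R]_n) v :
  <[A *m w, v]> = \sum_j w j 0 * <[col j A, v]>.
Proof.
rewrite /innerB trmx_mul -mulmxA mxE.
apply: eq_bigr => j _; rewrite [w^T _ _]mxE; congr (_ * _).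
by rewrite tr_col -row_mul [RHS]mxE.
Qed.

Definition innerBE :=
  (innerBDl, innerBDr, innerBNl, innerBNr, innerBZl, innerBZr).

Hypothesis B_posdef : sym_posdef B.

Lemma posdef_unitmx : B \in unitmx.
Proof.
case: B_posdef => Bsym Bpos; rewrite -row_free_unit; apply: inj_row_free => v vB0.
apply/eqP; rewrite -trmx_eq0; apply: contraT => /Bpos.
by rewrite trmxK vB0 mul0mx mxE ltxx.
Qed.

Lemma innerBC u v : <[u, v]> = <[v, u]>.
Proof.
have [Bsym _] := B_posdef.
have e : u^T *m (invmx B *m v) = (v^T *m (invmx B *m u))^T.
  by rewrite !trmx_mul trmxK trmx_inv Bsym mulmxA.
by rewrite /innerB e mxE.
Qed.

Lemma innerB_ge0 u : 0 <= <[u, u]>.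
Proof.
have [Bsym Bpos] := B_posdef.
have -> : <[u, u]> = ((invmx B *m u)^T *m B *m (invmx B *m u)) 0 0.
  by rewrite /innerB trmx_mul trmx_inv Bsym mulmxKV ?posdef_unitmx.
have [->|/Bpos/ltW//] := eqVneq (invmx B *m u) 0.
by rewrite mulmx0 mxE.
Qed.

Lemma sqr_normB u : normB B u ^+ 2 = <[u, u]>.
Proof. by rewrite sqr_sqrtr ?innerB_ge0. Qed.

(** [B] and its inverse cancel, leaving the Euclidean pairing with the gradient. *)
Lemma innerB_gradB (f : 'cV[R]_d -> R) u v :
  <[gradB f B u, v]> = ((gradient f u)^T *m v) 0 0.
Proof.
have [Bsym _] := B_posdef.
by rewrite /innerB /gradB trmx_mul Bsym mulmxA mulmxK ?posdef_unitmx.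
Qed.

End InnerProduct.

(** * First-order and cocoercivity inequalities for convex functions *)

Section Convex.
Variables (R : realType) (d : nat) (f : 'cV[R]_d -> R) (B : 'M[R]_d).
Hypothesis f_diff : forall y : 'cV[R]_d, differentiable f y.
Hypothesis B_posdef : sym_posdef B.
Implicit Types x y v : 'cV[R]_d.

Lemma derive_gradB x v : 'D_v f x = innerB B (gradB f B x) v.
Proof.
rewrite innerB_gradB// deriveE// {1}(matrix_sum_delta v) linear_sum mxE.
apply: eq_bigr => i _; rewrite big_ord1 linearZ !mxE deriveE//.
by rewrite mulrC.
Qed.

Lemma derive_cvg_right x v :
  h^-1 * (f (x + h *: v) - f x) @[h --> 0^'+] --> 'D_v f x.
Proof.
rewrite (_ : (fun h => _) = fun h => h^-1 *: ((f \o shift x) (h *: v) - f x)).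
  exact/cvg_dnbhs_at_right/diff_derivable.
by apply/funext => h /=; rewrite [_ + x]addrC.
Qed.

Hypothesis f_convex : convex_function [set: 'cV[R]_d] f.

(** Convexity on the segment bounds each difference quotient with [0 < h < 1] by [f y - f x], and
    the bound passes to the right-hand limit. *)
Lemma convex_first_order x y : f x + innerB B (gradB f B x) (y - x) <= f y.
Proof.
rewrite -derive_gradB -lerBrDl.
apply: (cvgr_to_le (@derive_cvg_right x (y - x))).
near=> h.
have h0 : 0 < h by near: h; exact: nbhs_right_gt.
have h1 : h < 1 by near: h; exact: nbhs_right_lt.
rewrite ler_pdivrMl//.
have -> : x + h *: (y - x) = h *: y + (1 - h) *: x.
  by rewrite scalerBr scalerBl scale1r addrCA addrC.
have : f (h *: y + (1 - h) *: x) <= h * f y + (1 - h) * f x.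
  exact: (@f_convex (Itv01 (ltW h0) (ltW h1)) y x (in_setT _) (in_setT _)).
lra.
Unshelve. all: by end_near. Qed.

(* Equality in the first-order inequality makes [y] a minimizer of
   [f - <grad f(x), .>]. *)
Lemma bregman_eq0 x y :
  f y - f x - innerB B (gradB f B x) (y - x) = 0 ->
  normB B (gradB f B x - gradB f B y) = 0.
Proof.
move=> fxy.
have dir v : innerB B (gradB f B x) v <= innerB B (gradB f B y) v.
  rewrite -(derive_gradB y); apply: (cvgr_to_ge (@derive_cvg_right y v)).
  near=> h.
  have h0 : 0 < h by near: h; exact: nbhs_right_gt.
  rewrite ler_pdivlMl// lerBrDl (le_trans _ (convex_first_order x _))//.
  rewrite [y + _ - x]addrAC innerBDr innerBZr; lra.
(* [dir] in the direction [gradB f B x - gradB f B y] makes the squared norm nonpositive. *)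
apply/eqP; rewrite -sqrf_eq0 eq_le sqr_ge0 sqr_normB// andbT.
by rewrite innerBDl innerBNl subr_le0.
Unshelve. all: by end_near. Qed.

(** A positive denominator is cleared. If it vanishes, the quotient defaults to 0 and its bound
    carries no information; [bregman_eq0] then removes the norm term. *)
Lemma Ltilde_cocoercive x y a : 0 < a -> Ltilde f B x y <= a ->
  f x + innerB B (gradB f B x) (y - x)
    + (2 * a)^-1 * normB B (gradB f B y - gradB f B x) ^+ 2 <= f y.
Proof.
move=> a0; rewrite /Ltilde.
have -> : normB B (gradB f B y - gradB f B x) = normB B (gradB f B x - gradB f B y).
  by rewrite /normB -opprB innerBNl innerBNr opprK.
set D := f y - _ - _; set n2 := normB _ _ ^+ 2.
have D0 : 0 <= D by have := convex_first_order x y; rewrite /D; lra.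
have [De|Dn] := eqVneq D 0.
  move=> _; rewrite /n2 bregman_eq0// expr0n/= mulr0 addr0.
  exact: convex_first_order.
rewrite ler_pdivrMr ?lt_def ?Dn ?D0// => n2D.
have : (2 * a)^-1 * n2 <= D.
  by rewrite invfM -mulrA mulrCA ler_pdivrMl// mulrC.
rewrite /D; lra.
Qed.

End Convex.

(** * One accelerated gradient step *)

Section Step.
Variables (R : realType) (d : nat) (B : 'M[R]_d).
Hypothesis B_posdef : sym_posdef B.

Local Notation "<[ u , v ]>" := (innerB B u v).
Local Notation "|[ u ]|" := (normB B u).

(* [t] is the aggregated weight [tau'] and [c] the increment [tau_n - tau']. *)
Lemma gradient_step (c t L fm fn fs D : R) (xm xn z xs gm gn : 'cV[R]_d) :
  0 < L -> 0 <= t -> 0 <= c -> t + c != 0 ->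
  xn = t / (t + c) *: (xm - L^-1 *: gm) + c / (t + c) *: z ->
  fn + <[gn, xm - xn]> + (2 * L)^-1 * |[gm - gn]| ^+ 2 <= fm ->
  fn + <[gn, xs - xn]> <= fs ->
  t * (fm - (2 * L)^-1 * |[gm]| ^+ 2 - fs) + L / 2 * |[z - xs]| ^+ 2 <= D ->
  (t + c) * (fn - fs) + (t - c ^+ 2) / (2 * L) * |[gn]| ^+ 2
    + L / 2 * |[z - (c / L) *: gn - xs]| ^+ 2 <= D.
Proof.
move=> L0 t0 c0 tc xnE; rewrite !sqr_normB// => cocoercive convex.
apply: le_trans; rewrite -subr_ge0.
set lhs := (X in _ <= X).
(* The gap is exactly the two slacks weighted by [t] and [c]; the [c ^+ 2] part of the coefficient
   of [|[gn]| ^+ 2] offsets the square of [(c / L) *: gn]. *)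
have -> : lhs = t * (fm - (fn + <[gn, xm - xn]>
                     + (2 * L)^-1 * <[gm - gn, gm - gn]>))
             + c * (fs - (fn + <[gn, xs - xn]>)).
  rewrite /lhs xnE !innerBE !(innerBC B_posdef _ gn) !(innerBC B_posdef xs z).
  by field; rewrite tc gt_eqF.
by rewrite addr_ge0 ?mulr_ge0 ?subr_ge0.
Qed.

End Step.

(** * Certificates along a run *)

Section Run.
Variables (R : realType) (d : nat) (f : 'cV[R]_d -> R) (B : 'M[R]_d).
Variables (k : nat) (x0 xs : 'cV[R]_d).
Variables (x : nat -> 'cV[R]_d) (tau : nat -> R) (z : nat -> 'cV[R]_d).
Variables (Delta L : nat -> R).
Hypothesis f_diff : forall y : 'cV[R]_d, differentiable f y.
Hypothesis f_convex : convex_function [set: 'cV[R]_d] f.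
Hypothesis B_posdef : sym_posdef B.

Local Notation "<[ u , v ]>" := (innerB B u v).
Local Notation "|[ u ]|" := (normB B u).
Local Notation g i := (gradB f B (x i)).

(** Multiplying by [tau i] instead of dividing also covers null steps; the distance term is what
    lets certificates be combined. *)
Definition certified i :=
  tau i * (f (x i) - (2 * L i)^-1 * |[g i]| ^+ 2 - f xs)
    + L i / 2 * |[z i.+1 - xs]| ^+ 2
  <= L i / 2 * |[x0 - xs]| ^+ 2 + Delta i.

Lemma certifiedE n m i : certified i ->
  acoef f B x0 x tau z L n m i + (vval f B x L n m - f xs) * tau i
    + L i * <[z i.+1 - x0, x0 - xs]> <= Delta i.
Proof.
rewrite /certified /acoef -[z i.+1 - xs](subrKA x0) !sqr_normB//.
rewrite (innerBDl _ _ (x0 - xs)) !(innerBDr _ _ _ (x0 - xs)).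
rewrite (innerBC B_posdef (x0 - xs) (z i.+1 - x0)); lra.
Qed.

Lemma bcoefE n m i :
  bcoef f B x0 x L n m i + (vval f B x L n m - f xs) - <[g i, x0 - xs]> <= 0.
Proof.
have := convex_first_order f_diff B_posdef f_convex (x i) xs.
rewrite /bcoef !innerBE; lra.
Qed.

(** Discarding only removes entries; hence aggregation refers to earlier indices only, as the
    induction requires. *)
Lemma mem_memory n i : i \in memory k tau n -> (i < n)%N.
Proof.
elim: n => [|n IHn]//= in i *.
have rc : i \in rcons (memory k tau n) n -> (i < n.+1)%N.
  by rewrite mem_rcons inE => /orP[/eqP->//|/IHn/ltnW].
case: ifP => _ // ; rewrite /discard; move: rc.
case: (rcons _ _) => [|j [|j' s]]//= rc; first by case: ifP.
by case: ifP => _ is_; apply: rc; move: is_; rewrite !inE => /orP[->|->];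
  rewrite ?orbT.
Qed.

Local Notation msize n := (size (memory k tau n)).
Local Notation Z n := (Zmat k x0 tau z L n).
Local Notation G n := (Gmat f B k x tau L n).

Lemma aggregate_certificates n m (rho gamma : 'cV[R]_(msize n)) :
  0 < L n -> (forall i, (i < n)%N -> certified i) ->
  feasible f B x0 x z L m rho gamma ->
  let z' := x0 + Z n *m rho - G n *m gamma in
  objective rho gamma * (vval f B x L n m - f xs) + L n / 2 * |[z' - xs]| ^+ 2
  <= L n / 2 * |[x0 - xs]| ^+ 2
     + (\sum_j rho j 0 * Delta (idx j) + delta f B k x tau L n).
Proof.
move=> Ln0 cert [slack0 rho0 gamma0] /=.
set w := Z n *m rho - G n *m gamma.
(* The column scalings by [L (idx j) / L n] and [(L n)^-1] turn the linear terms of all certificates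
   into one inner product. *)
have wE : L n * <[w, x0 - xs]> =
    \sum_j rho j 0 * (L (idx j) * <[z (idx j).+1 - x0, x0 - xs]>)
    - \sum_j gamma j 0 * <[g (idx j), x0 - xs]>.
  rewrite /w innerBDl innerBNl !innerB_mull mulrBr !mulr_sumr.
  congr (_ - _); apply: eq_bigr => j _.
    have -> : col j (Z n) =
        L (idx j) / L n *: (z (idx j).+1 - x0).
      by apply/colP => i; rewrite !mxE.
    by rewrite innerBZl; field; rewrite gt_eqF.
  have -> : col j (G n) = (L n)^-1 *: g (idx j).
    by apply/colP => i; rewrite !mxE.
  by rewrite innerBZl; field; rewrite gt_eqF.
have rhoE : \sum_j rho j 0 * acoef f B x0 x tau z L n m (idx j)
    + (vval f B x L n m - f xs) * \sum_j rho j 0 * tau (idx j)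
    + \sum_j rho j 0 * (L (idx j) * <[z (idx j).+1 - x0, x0 - xs]>)
    <= \sum_j rho j 0 * Delta (idx j).
  rewrite mulr_sumr -!big_split/=; apply: ler_sum => j _.
  rewrite mulrCA -!mulrDr ler_wpM2l//.
  by apply/certifiedE/cert/mem_memory/mem_nth.
have gammaE : \sum_j gamma j 0 * bcoef f B x0 x L n m (idx j)
    + (vval f B x L n m - f xs) * \sum_j gamma j 0
    - \sum_j gamma j 0 * <[g (idx j), x0 - xs]> <= 0.
  rewrite mulr_sumr -sumrN -!big_split/=; apply: sumr_le0 => j _.
  by rewrite [_ * gamma j 0]mulrC -mulrN -!mulrDr mulr_ge0_le0// bcoefE.
(* In the expanded square, the nonnegative slack pays for the [w] term and [wE] evaluates the cross
   term. *)
have -> : x0 + Z n *m rho - G n *m gamma - xs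
    = w + (x0 - xs).
  by rewrite -[x0 + _ - _]addrA -/w addrAC addrC.
move: slack0 rhoE gammaE; rewrite /slack -/w /objective !sqr_normB//.
rewrite (innerBDl _ w) !(innerBDr _ _ w) (innerBC B_posdef (x0 - xs) w).
lra.
Qed.

(** The reset values give equality, so null steps may stay in memory. *)
Lemma certified_null n : tau n = 0 -> z n.+1 = x0 -> Delta n = 0 -> certified n.
Proof. by move=> tn zn Dn; rewrite /certified tn zn Dn mul0r add0r addr0. Qed.

Lemma bspgm_step_certified N n :
  bspgm_step f B k x0 N x tau z Delta L n -> 0 < L n ->
  (forall i, (i < n)%N -> 0 <= tau i) ->
  (forall i, (i < n)%N -> certified i) ->
  [/\ 0 < L n.+1, 0 <= tau n, (n < N)%N -> certified n &
      ~~ (n < N)%N ->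
      tau n != 0 -> tau n * (f (x n) - f xs) <= L n / 2 * |[x0 - xs]| ^+ 2 + Delta n].
Proof.
case=> m [rho [gamma [_ [feas _]]]] + Ln0 tau_ge0 cert.
have := aggregate_certificates Ln0 cert feas; case: feas => _ rho0 gamma0.
have t0 : 0 <= objective rho gamma.
  by apply: addr_ge0; apply: sumr_ge0 => j _; rewrite ?mulr_ge0//
    tau_ge0// mem_memory// mem_nth.
move: (objective rho gamma) t0 => t t0 /=.
set z' := x0 + _ - _; set D' := \sum_j _; set tn := if _ then _ else _.
move=> aggr [xnE]; case: ltP => LL [];
  [move=> tau0 zx0 D0 -> | move=> tauE zE DE ->].
  (* Null step: the entry [2 * L n] of the maximum keeps [L n.+1] positive. *)
  have Hc := certified_null tau0 zx0 D0.
  by split; rewrite ?tau0 ?eqxx// lt_max [X in _ || X]mulr_gt0 ?orbT.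
pose c := tn - t; have tnE : tn = t + c by rewrite addrC subrK.
have sq0 := sqrtr_ge0 (1 + 8 * t).
have sqE : Num.sqrt (1 + 8 * t) ^+ 2 = 1 + 8 * t by rewrite sqr_sqrtr//; lra.
have c0 : 0 <= c.
  by rewrite /c /tn; case: ifP => _; have := sqrtr_ge0 t; lra.
have tn0 : 0 <= tn by rewrite tnE addr_ge0.
(* The guard fails only on a final step with [t = 0], where [tn = 0]. *)
have step : tn != 0 -> tn * (f (x n) - f xs)
    + (t - c ^+ 2) / (2 * L n) * |[g n]| ^+ 2 + L n / 2 * |[z n.+1 - xs]| ^+ 2
    <= L n / 2 * |[x0 - xs]| ^+ 2 + Delta n.
  rewrite tnE => tn_neq0; rewrite zE DE.
  have {}xnE : x n = t / (t + c) *: (x m - (L n)^-1 *: g m) + c / (t + c) *: z'.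
    by rewrite -tnE.
  exact: (gradient_step B_posdef Ln0 t0 c0 tn_neq0 xnE
    (Ltilde_cocoercive f_diff B_posdef f_convex Ln0 LL)
    (convex_first_order f_diff B_posdef f_convex (x n) xs) aggr).
split=> //; rewrite ?tauE//.
  move=> nN; have cE : c = (1 + Num.sqrt (1 + 8 * t)) / 2.
    by rewrite /c /tn nN addrAC subrr add0r.
  have tn_neq0 : tn != 0 by rewrite gt_eqF// tnE; lra.
  (* [c] is the positive root of [c ^+ 2 = c + 2 * t]. *)
  have c2 : t - c ^+ 2 = - tn by rewrite tnE cE; lra.
  have := step tn_neq0; rewrite /certified tauE c2 => /(le_trans _); apply.
  by rewrite le_eqVlt; apply/orP; left; apply/eqP; field; rewrite gt_eqF.
(* Final step: [c ^+ 2 = t] cancels the gradient term, and the distance term is dropped. *)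
move=> /negbTE nN; have cE : c = Num.sqrt t.
  by rewrite /c /tn nN addrAC subrr add0r.
move=> /step; rewrite cE sqr_sqrtr// subrr !mul0r addr0 => /(le_trans _); apply.
by rewrite lerDl mulr_ge0 ?sqr_ge0 ?divr_ge0// ltW.
Qed.

End Run.

Theorem theorem3p2 (R : realType) (d : nat)
    (f : 'cV[R]_d -> R) (B : 'M[R]_d) (xstar x0 : 'cV[R]_d) (L0 : R)
    (k N T : nat)
    (x : nat -> 'cV[R]_d) (tau : nat -> R) (z : nat -> 'cV[R]_d)
    (Delta L : nat -> R)
    (f_convex : convex_function [set: 'cV[R]_d] f)
    (f_diff : forall y : 'cV[R]_d, differentiable f y)
    (f_grad_lip : locally_lipschitz (gradient f))
    (xstar_min : forall y : 'cV[R]_d, f xstar <= f y)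
    (B_posdef : sym_posdef B)
    (L0_gt0 : 0 < L0)
    (N_gt0 : (0 < N)%N)
    (run : bspgm_run f B k x0 L0 N x tau z Delta L T) :
  forall n, (n <= T)%N -> tau n != 0 ->
    ((n < N)%N ->
       f (x n) - 1 / (2 * L n) * normB B (gradB f B (x n)) ^+ 2 - f xstar
         <= (L n / 2 * normB B (x0 - xstar) ^+ 2 + Delta n) / tau n) /\
    (n = N ->
       f (x N) - f xstar
         <= (L N / 2 * normB B (x0 - xstar) ^+ 2 + Delta N) / tau N).
Proof.
have [init steps stop] := run.
have TN : (T <= N)%N by case: stop => [->//|[/ltnW]].
(* Strong induction, since memory may reach far back; [0 < L n.+1] is carried because the next step
   needs it. *)
have inv n : (n <= T)%N -> [/\ 0 < L n, 0 < L n.+1, 0 <= tau n,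
    (n < N)%N -> certified f B x0 xstar x tau z Delta L n &
    ~~ (n < N)%N -> tau n != 0 -> tau n * (f (x n) - f xstar)
      <= L n / 2 * normB B (x0 - xstar) ^+ 2 + Delta n].
  elim/ltn_ind: n => -[_ _|n IHn nT].
    have [x_0 tau_0 z_1 D_0 [L_0 L_1]] := init.
    split; rewrite ?L_0 ?L_1 ?tau_0 ?N_gt0// => _.
    (* Since [z 1] is a plain gradient step, the squared gradient terms cancel and the first-order
       inequality remains. *)
    rewrite /certified z_1 x_0 tau_0 D_0 L_0 mul1r addr0.
    have := convex_first_order f_diff B_posdef f_convex x0 xstar.
    rewrite -(opprB x0 xstar) (addrAC x0 _ (- xstar)).
    move: (x0 - xstar) => u.
    rewrite !sqr_normB// !innerBE (innerBC B_posdef u (gradB f B x0)).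
    move=> first_order; rewrite -subr_ge0; move: first_order; rewrite -subr_ge0.
    by congr (is_true (0 <= _)); field; rewrite gt_eqF.
  have prev i : (i < n.+1)%N -> (i <= T)%N by move=> /ltnW/leq_trans; apply.
  have [_ Ln1 _ _ _] := IHn n (ltnSn n) (prev n (ltnSn n)).
  have [i ni|i ni|? ? ? ?] := bspgm_step_certified (xs := xstar) f_diff f_convex
    B_posdef (steps n.+1 nT) Ln1.
  - by have [] := IHn i ni (prev i ni).
  (* Indices before [n.+1] lie strictly below [N], so their certificates are available. *)
  - have [_ _ _ + _] := IHn i ni (prev i ni); apply.
    exact: leq_trans (leq_trans ni nT) TN.
  - by split.
move=> n nT tau_neq0; have [Ln _ tau_ge0 cert fin] := inv n nT.
have tau_gt0 : 0 < tau n by rewrite lt_def tau_neq0.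
split=> [nN|nN]; last first.
  by subst n; rewrite ler_pdivlMr// mulrC fin// ltnn.
rewrite div1r ler_pdivlMr// mulrC (le_trans _ (cert nN))// lerDl.
by rewrite mulr_ge0 ?sqr_ge0 ?divr_ge0// ltW.
Qed.
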